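(* Let $A$ and $B$ be two isogenous complex elliptic curves such that the $j$-invariant $j(B)$ is either $0$ or $1728$. Then there exists an isogeny $\psi:B\to A$ such that $$\mathrm{Hom}(B,A)=\langle\psi,\psi\circ\lambda_B\rangle$$ as a $\mathbb{Z}$-module.
   Context: $\mathrm{Hom}(B,A)$ is the group of homomorphisms of elliptic curves (preserving the origin). $\lambda_B$ denotes an automorphism of the elliptic curve $B$ (fixing the origin) of order $3$ if $j(B)=0$, and of order $4$ if $j(B)=1728$. $\langle\cdot,\cdot\rangle$ denotes the subgroup generated by the listed elements. *)

(* Defs.v *)
From HB Require Import structures.
From mathcomp Require Import all_boot all_order all_algebra.
From mathcomp Require Import generic_quotient ring_quotient.
From mathcomp Require Import all_classical all_reals all_analysis.
From mathcomp Require Import summability.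
From mathcomp Require Import complex.

Set Implicit Arguments.
Unset Strict Implicit.
Unset Printing Implicit Defensive.

Import Order.TTheory GRing.Theory Num.Theory.
Import numFieldNormedType.Exports.

Local Open Scope classical_set_scope.
Local Open Scope ring_scope.

(* The complex numbers, bundled as a numClosedFieldType so that the topology
   and the derivatives of MathComp-Analysis apply: derivability of
   [f : Cplx R -> Cplx R] in the direction [1] is complex differentiability. *)
Definition Cplx (R : realType) : numClosedFieldType := R[i].

Definition ofReal (R : realType) (a : R) : Cplx R := a%:C%C.

Definition is_basis (R : realType) (L : {pred Cplx R}) (w1 w2 : Cplx R) : Prop :=
  (forall a b : R, ofReal a * w1 + ofReal b * w2 = 0 -> a = 0 /\ b = 0) /\
  (forall z : Cplx R, z \in L <-> exists m n : int, z = w1 *~ m + w2 *~ n).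

(* A complex elliptic curve is a complex torus of dimension one, the quotient
   of the complex plane by a lattice, whose origin is the class of [0]. *)
Record ellipticCurve (R : realType) := EllipticCurve {
  period : zmodClosed (Cplx R);
  period_basis : exists w1 w2 : Cplx R, is_basis period w1 w2
}.

Definition points (R : realType) (X : ellipticCurve R) : zmodType :=
  Quotient.quot (period X).

Coercion points : ellipticCurve >-> zmodType.

Definition unif (R : realType) (X : ellipticCurve R) (z : Cplx R) : X :=
  (\pi_(Quotient.quot (period X)) z)%qT.

(* The charts of [X] and [Y] are the local inverses of [unif X] and [unif Y],
   so [f] is holomorphic iff, near every point, it is induced by a holomorphic
   function of the complex variable. *)
Definition holomorphic (R : realType) (X Y : ellipticCurve R) (f : X -> Y) : Prop :=
  forall z : Cplx R, exists g : Cplx R -> Cplx R,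
    \forall w \near z, derivable g w 1 /\ f (unif X w) = unif Y (g w).

(* Homomorphisms of elliptic curves: holomorphic maps respecting the group
   laws. [ellHom X Y] is a subset of the additive group of all maps [X -> Y],
   with pointwise addition. *)
Definition ellHom (R : realType) (X Y : ellipticCurve R) : set (X -> Y) :=
  [set f | (forall x y : X, f (x + y) = f x + f y) /\ holomorphic f].

Arguments ellHom {R} X Y _.

Definition isogeny (R : realType) (X Y : ellipticCurve R) (f : X -> Y) : Prop :=
  [/\ ellHom X Y f, range f = setT & finite_set (f @^-1` [set 0])].

Definition isogenous (R : realType) (X Y : ellipticCurve R) : Prop :=
  exists f : X -> Y, isogeny f.

Definition automorphism (R : realType) (X : ellipticCurve R) (f : X -> X) : Prop :=
  ellHom X X f /\ exists2 g : X -> X, ellHom X X g & cancel f g /\ cancel g f.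

Definition has_order (T : Type) (f : T -> T) (n : nat) : Prop :=
  [/\ (0 < n)%N, iter n f =1 id &
      forall m : nat, (0 < m < n)%N -> ~ (iter m f =1 id)].

(* The sum of [w ^- k] over the nonzero periods, as the limit of the sums over
   finite sets; it converges for [2 < k]. *)
Definition eisenstein (R : realType) (X : ellipticCurve R) (k : nat) : Cplx R :=
  summability.sum (R := Cplx R)
    (fun w : Cplx R => if (w \in period X) && (w != 0) then w ^- k else 0).

(* The Weierstrass invariants: the cubic model of [X] is
   y ^ 2 = 4 x ^ 3 - g2 x - g3. *)
Definition g2 (R : realType) (X : ellipticCurve R) : Cplx R := 60 * eisenstein X 4.
Definition g3 (R : realType) (X : ellipticCurve R) : Cplx R := 140 * eisenstein X 6.

Definition jinv (R : realType) (X : ellipticCurve R) : Cplx R :=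
  1728 * (g2 X ^+ 3 / (g2 X ^+ 3 - 27 * g3 X ^+ 2)).

Definition is_subgroup (V : zmodType) (H : set V) : Prop :=
  H 0 /\ forall x y : V, H x -> H y -> H (x - y).

Definition subgroup_gen (V : zmodType) (S : set V) : set V :=
  smallest (@is_subgroup V) S.

(* Main.v *)
Require Import Defs.
From mathcomp Require Import all_boot all_order all_algebra.
From mathcomp Require Import generic_quotient ring_quotient.
From mathcomp Require Import all_classical all_reals all_analysis.
From mathcomp Require Import complex.
From mathcomp Require Import ring lra.
Import Order.TTheory GRing.Theory Num.Theory.
Import numFieldNormedType.Exports.

Local Open Scope classical_set_scope.
Local Open Scope ring_scope.
Set Implicit Arguments.
Unset Strict Implicit.
Unset Printing Implicit Defensive.

(** A homomorphism of complex tori lifts to multiplication by one complex number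
    (ellHom_lifts), so Hom(B, A) is identified with the group H of all [b] that
    map the lattice of B into the lattice of A ([multipliers B A]).  This group
    is discrete, because it embeds into the lattice of A by evaluation at a
    nonzero period of B, and it is nonzero: if [a] is the multiplier of an
    isogeny from A to B, then [a] times the lattice of A has finite index in the
    lattice of B, and if [D] kills the quotient then [D / a] lies in H.

    The automorphism lambda lifts to multiplication by some [c].  The
    j-invariant enters through the order of lambda, which is 3 or 4 and gives
    [c ^ 2 + c + 1 = 0] or [c ^ 2 = -1]; so [Z[c]] is the ring of Eisenstein or
    Gaussian integers.  Precomposition with lambda makes H a [Z[c]]-module.
    Every complex number lies at distance less than 1 from [Z[c]], and Euclidean
    division then shows that a nonzero element [a] of nearly minimal norm
    generates H over [Z[c]] (quadratic_module_cyclic).  Thus H is generated as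
    a group by [a] and [a * c], the multipliers of psi and of psi \o lambda. *)

(** * The uniformization of a torus *)

Section Unif.
Variables (R : realType) (X : ellipticCurve R).

Lemma unif_surj (x : X) : exists z, x = unif X z.
Proof. by exists (repr x); rewrite /unif reprK. Qed.

Lemma unifD z w : unif X (z + w) = unif X z + unif X w.
Proof. by rewrite /unif !piE. Qed.

Lemma unifN z : unif X (- z) = - unif X z.
Proof. by rewrite /unif !piE. Qed.

Lemma unif_eq z w : unif X z = unif X w <-> z - w \in period X.
Proof.
rewrite -Quotient.equivE; split; first by move/eqmodP.
by move=> h; apply/eqmodP.
Qed.

Lemma unif0 : unif X 0 = 0.
Proof. by rewrite /unif !piE. Qed.

Lemma unifMz z n : unif X (z *~ n) = unif X z *~ n.
Proof.
have hn (m : nat) : unif X (z *+ m) = unif X z *+ m.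
  by elim: m => [|m IH]; rewrite ?mulr0n ?unif0 // !mulrS unifD IH.
by case: n => m; rewrite ?NegzE ?mulrNz ?unifN -!pmulrn hn.
Qed.

End Unif.

(** * The squared modulus *)

Section ComplexNorm.
Variable R : realType.
Implicit Types z w : Cplx R.

(** The squared modulus as an element of [R]: unlike the norm of [Cplx R], which
    is a complex number, it can be compared in a total order and has infima. *)
Definition sqn z : R := complex.Re z ^+ 2 + complex.Im z ^+ 2.

Lemma sqnM z w : sqn (z * w) = sqn z * sqn w.
Proof. by case: z w => [a b] [c d]; rewrite /sqn /=; ring. Qed.

Lemma sqn_ge0 z : 0 <= sqn z.
Proof. by rewrite addr_ge0 ?sqr_ge0. Qed.

Lemma sqn_eq0 z : (sqn z == 0) = (z == 0).
Proof.
case: z => a b; rewrite eq_complex /sqn /= paddr_eq0 ?sqr_ge0 //.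
by rewrite !sqrf_eq0.
Qed.

Lemma sqn_gt0 z : (0 < sqn z) = (z != 0).
Proof. by rewrite lt_def sqn_ge0 andbT sqn_eq0. Qed.

Lemma ofReal_sqn z : ofReal (sqn z) = `|z| ^+ 2.
Proof. by rewrite /ofReal /sqn add_Re2_Im2. Qed.

(** The signed area of the parallelogram spanned by [z] and [w]. *)
Definition wedge z w : R :=
  complex.Re z * complex.Im w - complex.Re w * complex.Im z.

(** The difference of the two sides is the square of the scalar product of [z]
    and [w]. *)
Lemma wedge_bound z w : wedge z w ^+ 2 <= sqn z * sqn w.
Proof.
rewrite -subr_ge0.
suff -> : sqn z * sqn w - wedge z w ^+ 2 =
  (complex.Re z * complex.Re w + complex.Im z * complex.Im w) ^+ 2 by exact: sqr_ge0.
by rewrite /sqn /wedge; ring.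
Qed.

Lemma wedge_lincomb (a b : R) z w :
  wedge (ofReal a * z + ofReal b * w) w = a * wedge z w /\
  wedge (ofReal a * z + ofReal b * w) z = - b * wedge z w.
Proof. by case: z w => [x y] [x' y']; rewrite /wedge /=; split; ring. Qed.

Lemma ofReal_int (n : int) : ofReal n%:~R = n%:~R :> Cplx R.
Proof. exact: rmorph_int. Qed.

(** Repeated halving brings every complex number into any given ball around 0;
    [x] and [d] stand for norms, which are complex numbers here. *)
Lemma Cplx_expn2_archi (x d : Cplx R) : 0 <= x -> 0 < d ->
  exists n, x < d * 2 ^+ n.
Proof.
case: x d => [x x'] [d d']; rewrite lecE ltcE /= => /andP[/eqP-> x0] /andP[/eqP-> d0].
have [n hn] : exists n, x / d < 2 ^+ n.
  exists (Num.bound (x / d)); rewrite (lt_le_trans (archi_boundP _)) ?divr_ge0 ?(ltW d0) //.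
  by rewrite -natrX ler_nat ltnW // ltn_expl.
exists n; have -> : (2 ^+ n : Cplx R) = ofReal (2 ^+ n).
  by rewrite /ofReal rmorphXn /= rmorph_nat.
rewrite ltcE /= mulr0 mul0r addr0 eqxx /= mul0r subr0.
by rewrite mulrC -ltr_pdivrMr.
Qed.
End ComplexNorm.

(** * Discreteness of lattices *)

Section Lattice.
Variables (R : realType) (L : {pred Cplx R}) (w1 w2 : Cplx R).
Hypothesis basis : is_basis L w1 w2.

(** If the area vanished, the coordinates of [w1] and [w2] would give linear
    relations between them, which forces all of them to be 0. *)
Lemma basis_wedge_neq0 : wedge w1 w2 != 0.
Proof.
apply/eqP; case: basis => free _; move: free.
rewrite /wedge; case: w1 w2 => [x1 y1] [x2 y2] /= free D0.
have [y20 /eqP y10] : y2 = 0 /\ - y1 = 0.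
  apply: free; apply/eqP; rewrite eq_complex /=.
  by apply/andP; split; apply/eqP; [rewrite -[RHS]D0|]; ring.
have [x20 /eqP x10] : x2 = 0 /\ - x1 = 0.
  apply: free; apply/eqP; rewrite eq_complex /=.
  apply/andP; split; apply/eqP; first by ring.
  by rewrite -[RHS]oppr0 -[in RHS]D0; ring.
have [] := free 1 0; last by move/eqP; rewrite oner_eq0.
rewrite !oppr_eq0 in y10 x10; apply/eqP.
rewrite (eqP x10) (eqP y10) x20 y20 eq_complex /=.
by apply/andP; split; apply/eqP; ring.
Qed.

Lemma basis_lincomb0 (m n : int) : w1 *~ m + w2 *~ n = 0 -> m = 0 /\ n = 0.
Proof.
case: basis => free _; rewrite -(mulrzl w1) -(mulrzl w2) -!ofReal_int.
by move=> /free[/eqP + /eqP]; rewrite !intr_eq0 => /eqP-> /eqP->.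
Qed.

(** For [z = w1 *~ m + w2 *~ n], the areas of [z] with [w2] and with [w1] are
    [m] and [- n] times the area of the basis, and an area is at most the
    product of the moduli; so [z] is bounded below as soon as [m] or [n] is
    nonzero. *)
Lemma lattice_discrete :
  exists2 e : R, 0 < e & forall z, z \in L -> z != 0 -> e <= sqn z.
Proof.
have D0 := basis_wedge_neq0.
have w0 : 0 < sqn w1 + sqn w2.
  rewrite lt_def addr_ge0 ?sqn_ge0 // andbT paddr_eq0 ?sqn_ge0 // !sqn_eq0.
  by apply: contra D0 => /andP[/eqP-> /eqP->]; rewrite /wedge /= !mul0r subr0.
exists (wedge w1 w2 ^+ 2 / (sqn w1 + sqn w2)).
  by rewrite divr_gt0 // lt_def sqr_ge0 sqrf_eq0 D0.
move=> z /(basis.2 z).1 [m [n zE]] z0; rewrite ler_pdivrMr //.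
have int_sq (k : int) : k != 0 -> 1 <= (k%:~R : R) ^+ 2.
  move=> k0; rewrite -rmorphXn /= -[1]/(1%:~R) ler_int.
  by rewrite -gtz0_ge1 lt_def sqr_ge0 sqrf_eq0 k0.
have wE : z = ofReal m%:~R * w1 + ofReal n%:~R * w2.
  by rewrite zE !ofReal_int !mulrzl.
have [c1 c2] := wedge_lincomb m%:~R n%:~R w1 w2; rewrite -wE in c1 c2.
have le k (w : Cplx R) : k != 0 -> (k%:~R * wedge w1 w2) ^+ 2 = wedge z w ^+ 2 ->
    wedge w1 w2 ^+ 2 <= sqn z * sqn w.
  move=> k0 h; apply: le_trans (wedge_bound z w); rewrite -h exprMn.
  by rewrite ler_peMl ?sqr_ge0 ?int_sq.
rewrite mulrDr; case: (eqVneq m 0) => [m0|m0].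
  have n0 : n != 0 by apply: contra z0 => /eqP n0; rewrite zE m0 n0 !mulr0z addr0.
  by rewrite ler_wpDr ?mulr_ge0 ?sqn_ge0 // (le n) // c2; ring.
by rewrite ler_wpDl ?mulr_ge0 ?sqn_ge0 // (le m) // c1; ring.
Qed.

End Lattice.

Section Curve.
Variables (R : realType) (X : ellipticCurve R).

Lemma period_discrete :
  exists2 e : R, 0 < e & forall z, z \in period X -> z != 0 -> e <= sqn z.
Proof. by have [w1 [w2 b]] := period_basis X; exact: lattice_discrete b. Qed.

Lemma period_discrete_norm :
  exists2 e : Cplx R, 0 < e & forall z, z \in period X -> `|z| < e -> z = 0.
Proof.
have [e e0 he] := period_discrete.
exists (ofReal (Num.sqrt e)); first by rewrite ltcR sqrtr_gt0.
move=> z zX ze; apply/eqP; apply: contraLR ze => /(he z zX) ez.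
rewrite -real_leNgt ?realE ?normr_ge0 ?ler0c ?sqrtr_ge0 //.
rewrite -(@ler_pXn2r _ 2) ?nnegrE ?normr_ge0 ?ler0c ?sqrtr_ge0 //.
by rewrite -ofReal_sqn /ofReal -rmorphXn /= sqr_sqrtr ?(ltW e0) // lecR.
Qed.

Lemma period_nonzero : exists2 w, w \in period X & w != 0.
Proof.
have [w1 [w2 b]] := period_basis X; exists w1.
  by apply/(b.2 w1); exists 1, 0; rewrite mulr1z mulr0z addr0.
apply/eqP => w0; have := basis_wedge_neq0 b.
by rewrite w0 /wedge /= mul0r mulr0 subr0 eqxx.
Qed.

End Curve.

(** * Lifting homomorphisms to multiplications *)

Section Lift.
Variables (R : realType) (X Y : ellipticCurve R).
Implicit Types (f : X -> Y) (a z w : Cplx R).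

Definition multipliers : set (Cplx R) :=
  [set b | forall z, z \in period X -> b * z \in period Y].

Definition lifts f a := forall z, f (unif X z) = unif Y (a * z).

Lemma norm_div2X n w : `|w / 2 ^+ n| = `|w| / 2 ^+ n.
Proof. by rewrite normrM normfV normrX normr_nat. Qed.

(** The relation gives [h w / w = h (w / 2 ^ n) / (w / 2 ^ n)] for every [n], and
    the right-hand side tends to the derivative of [h] at 0. *)
Lemma doubling_linear (h : Cplx R -> Cplx R) (d : Cplx R) :
  0 < d -> h 0 = 0 -> derivable h 0 1 ->
  (forall w, `|w| < d -> h w = h (w / 2) *+ 2) ->
  exists a, forall w, `|w| < d -> h w = a * w.
Proof.
move=> d0 h0 /cvg_ex[a dh] hD; exists a => w wd.
have hn n : h w = h (w / 2 ^+ n) * 2 ^+ n.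
  elim: n => [|n ->]; first by rewrite expr0 divr1 mulr1.
  rewrite hD; last first.
    rewrite norm_div2X; apply: le_lt_trans wd.
    by rewrite ler_piMr // invf_le1 ?exprn_gt0 // exprn_ege1 // ler1n.
  have -> : w / 2 ^+ n.+1 = w / 2 ^+ n / 2 by rewrite exprSr invfM mulrA.
  by rewrite exprS (mulrA _ 2) mulr_natr.
have [->|w0] := eqVneq w 0; first by rewrite h0 mulr0.
suff /eqP : `|h w / w - a| = 0.
  by rewrite normr_eq0 subr_eq0 => /eqP <-; rewrite divfK.
apply/eqP/negPn/negP => e0.
have {}e0 : 0 < `|h w / w - a| by rewrite lt_def e0 normr_ge0.
have /cvgrPdist_lt/(_ _ e0) := dh.
rewrite /dnbhs /within /= => /nbhs_ballP[r /= r0 hr].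
have [n nP] := Cplx_expn2_archi (normr_ge0 w) r0.
have /hr : ball (0 : Cplx R) r (w / 2 ^+ n).
  rewrite /ball /= sub0r normrN norm_div2X.
  by rewrite ltr_pdivrMr ?exprn_gt0.
have u0 : w / 2 ^+ n != 0 by rewrite mulf_neq0 // invr_neq0 // expf_neq0.
move=> /(_ u0); rewrite addr0 h0 subr0 /GRing.scale /= mulr1.
rewrite -normrN opprB invfM invrK mulrAC -mulrA -hn.
by rewrite mulrC ltxx.
Qed.

Lemma ellHom0 f : ellHom X Y f -> f 0 = 0.
Proof. by case=> fD _; apply: (addrI (f 0)); rewrite -fD !addr0. Qed.

(** Near 0 the homomorphism is induced by a differentiable [g].  Additivity of
    [f] puts [g w - 2 g (w / 2) + g 0] in the lattice of [Y], and by continuity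
    of [g] this number is small, hence 0 by discreteness.  So [g - g 0] commutes
    with doubling and is linear near 0.  Additivity of [f] extends the formula
    from a ball to the whole plane. *)
Lemma ellHom_lifts f : ellHom X Y f -> exists a, lifts f a.
Proof.
move=> hf; have f0 := ellHom0 hf; case: hf => fD /(_ 0) [g gP].
have [e e0 he] := period_discrete_norm Y.
have e3 : 0 < e / 3 by rewrite divr_gt0.
have [dg fg] := nbhs_singleton gP.
have gc : {for 0, continuous g}.
  by apply/differentiable_continuous/derivable1_diffP.
have /cvgrPdist_lt/(_ _ e3) gnear := gc.
have : \forall w \near (0 : Cplx R),
    f (unif X w) = unif Y (g w) /\ `|g 0 - g w| < e / 3.
  by near=> w; split; [near: w; apply: filterS gP => w []|near: w].
move=> /nbhs_ballP[d /= d0 hd].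
have hd' w : `|w| < d -> f (unif X w) = unif Y (g w) /\ `|g 0 - g w| < e / 3.
  by move=> wd; apply: hd; rewrite /ball /= sub0r normrN.
have g0 : unif Y (g 0) = 0 by rewrite -fg unif0.
pose h w := g w - g 0.
have [a ha] : exists a, forall w, `|w| < d -> h w = a * w.
  apply: (doubling_linear d0).
  - by rewrite /h subrr.
  - by apply: derivableB; [exact: dg|exact: derivable_cst].
  - move=> w wd.
    have w2d : `|w / 2| < d.
      rewrite normrM normfV normr_nat (le_lt_trans _ wd) //.
      by rewrite ler_piMr // invf_le1 // ler1n.
    have [fw nw] := hd' _ wd; have [fw2 nw2] := hd' _ w2d.
    apply/eqP; rewrite -subr_eq0; apply/eqP; apply: he.
      rewrite -[_ - _]subr0; apply/unif_eq.
      rewrite unif0 /h mulr2n !(unifD, unifN) g0 !subr0 -fw -fw2.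
      rewrite -fD -unifD -splitr subrr //.
    (* the period is h w - 2 h (w / 2), and both values of h are below e / 3 *)
    have -> : e = e / 3 + (e / 3 + e / 3) by field.
    rewrite (le_lt_trans (ler_normB _ _)) // ltrD //.
      by rewrite /h -normrN opprB.
    by rewrite mulr2n (le_lt_trans (ler_normD _ _)) // ltrD // /h -normrN opprB.
exists a => z.
have [n nP] := Cplx_expn2_archi (normr_ge0 z) d0.
have fMn x k : f (x *+ k) = f x *+ k.
  by elim: k => [|k IH]; rewrite ?mulr0n // !mulrS fD IH.
have zn : `|z / 2 ^+ n| < d.
  by rewrite norm_div2X ltr_pdivrMr ?exprn_gt0.
have zE : z = z / 2 ^+ n *~ (2 ^ n)%N.
  by rewrite -pmulrn -[RHS]mulr_natr natrX divfK // expf_neq0.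
rewrite [in LHS]zE unifMz -pmulrn fMn (hd' _ zn).1.
have -> : g (z / 2 ^+ n) = a * (z / 2 ^+ n) + g 0 by rewrite -(ha _ zn) /h subrK.
by rewrite unifD g0 addr0 pmulrn -unifMz -mulrzAr -zE.
Unshelve. all: by end_near. Qed.

Lemma lifts_multiplier f a : ellHom X Y f -> lifts f a -> multipliers a.
Proof.
move=> /ellHom0 f0 fa z zX; rewrite -[a * z]subr0; apply/unif_eq.
rewrite -fa unif0 -f0 -(unif0 X); congr f; by apply/unif_eq; rewrite subr0.
Qed.

(** Independent of the representative [repr x] when [a] is a multiplier. *)
Definition mulHom a : X -> Y := fun x => unif Y (a * repr x).

Lemma mulHom_lifts a : multipliers a -> lifts (mulHom a) a.
Proof.
move=> aXY z; apply/unif_eq; rewrite -mulrBr; apply: aXY.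
by apply/unif_eq; rewrite /unif reprK.
Qed.

Lemma lifts_ellHom f a : lifts f a -> ellHom X Y f.
Proof.
move=> fa; split.
  move=> x y; have [z ->] := unif_surj x; have [w ->] := unif_surj y.
  by rewrite -unifD !fa mulrDr unifD.
move=> z; exists (fun w => a * w); near=> w; split; last exact: fa.
by apply: derivableM; [exact: derivable_cst|exact: derivable_id].
Unshelve. all: by end_near. Qed.

Lemma lifts_inj f g a : lifts f a -> lifts g a -> f = g.
Proof.
by move=> fa ga; apply: funext => x; have [z ->] := unif_surj x; rewrite fa ga.
Qed.

(** [(a - b) * z] is a period of [Y] for arbitrarily small nonzero [z]. *)
Lemma unif_mul_eq a b : (forall z, unif Y (a * z) = unif Y (b * z)) -> a = b.
Proof.
move=> ab; have [e e0 he] := period_discrete_norm Y.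
apply/eqP; rewrite -subr_eq0; apply/eqP.
have [n nP] := Cplx_expn2_archi (normr_ge0 (a - b)) e0.
have : (a - b) / 2 ^+ n = 0.
  apply: he; first by rewrite mulrBl; apply/unif_eq.
  by rewrite norm_div2X ltr_pdivrMr ?exprn_gt0.
by move/eqP; rewrite mulf_eq0 invr_eq0 expf_eq0 pnatr_eq0 andbF orbF => /eqP.
Qed.

Lemma liftsB (f g : X -> Y) a b :
  lifts f a -> lifts g b -> lifts (f - g) (a - b).
Proof.
by move=> fa gb z; rewrite mulrBl unifD unifN -fa -gb.
Qed.

Lemma lifts0 : lifts (0 : X -> Y) 0.
Proof. by move=> z; rewrite mul0r unif0. Qed.

End Lift.

Lemma lifts_comp (R : realType) (X Y Z : ellipticCurve R)
    (f : Y -> Z) (g : X -> Y) a b :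
  lifts f a -> lifts g b -> lifts (f \o g) (a * b).
Proof. by move=> fa gb z; rewrite /= gb fa mulrA. Qed.

(** * Nonzero multipliers are isogenies *)

Section Isogeny.
Variables (R : realType) (X Y : ellipticCurve R) (a : Cplx R).
Hypothesis a0 : a != 0.
Hypothesis aXY : multipliers X Y a.

(** [D] is the determinant of multiplication by [a] in the two bases; the inverse
    matrix has entries in [D^-1 Z] by Cramer's rule. *)
Lemma mul_period_index : exists2 D : int, D != 0 &
  forall z, z \in period Y -> z *~ D / a \in period X.
Proof.
have [x1 [x2 bX]] := period_basis X; have [y1 [y2 bY]] := period_basis Y.
have x1X : x1 \in period X.
  by apply/(bX.2 _); exists 1, 0; rewrite mulr1z mulr0z addr0.
have x2X : x2 \in period X.
  by apply/(bX.2 _); exists 0, 1; rewrite mulr1z mulr0z add0r.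
have [p [q E1]] := (bY.2 _).1 (aXY x1X).
have [r [s E2]] := (bY.2 _).1 (aXY x2X).
have D1 : a * (x1 *~ s + x2 *~ (- q)) = y1 *~ (p * s - q * r).
  rewrite mulrDr !mulrzAr E1 E2 -!(mulrzl y1) -!(mulrzl y2) -!(mulrzl (_ + _)).
  by rewrite !(rmorphB, rmorphM, rmorphN) /=; ring.
have D2 : a * (x1 *~ (- r) + x2 *~ p) = y2 *~ (p * s - q * r).
  rewrite mulrDr !mulrzAr E1 E2 -!(mulrzl y1) -!(mulrzl y2) -!(mulrzl (_ + _)).
  by rewrite !(rmorphB, rmorphM, rmorphN) /=; ring.
exists (p * s - q * r).
  apply/eqP => D0; move: D1 D2; rewrite D0 !mulr0z => /eqP + /eqP.
  rewrite !mulf_eq0 (negPf a0) /= => /eqP/(basis_lincomb0 bX)[_ /eqP q0].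
  move=> /eqP/(basis_lincomb0 bX)[_ p0]; move/eqP: E1.
  rewrite p0; rewrite oppr_eq0 in q0; rewrite (eqP q0) !mulr0z addr0 mulf_eq0.
  rewrite (negPf a0) /= => /eqP x10.
  by have := basis_wedge_neq0 bX; rewrite x10 /wedge /= mul0r mulr0 subr0 eqxx.
move=> z /(bY.2 z).1 [m [n ->]].
have -> : (y1 *~ m + y2 *~ n) *~ (p * s - q * r) / a =
    (x1 *~ s + x2 *~ (- q)) *~ m + (x1 *~ (- r) + x2 *~ p) *~ n.
  apply: (mulfI a0); rewrite mulrC divfK // mulrDr !mulrzAr D1 D2.
  by rewrite mulrzDl -!mulrzA mulrC [n * _]mulrC.
by rewrite rpredD // rpredMz // rpredD // rpredMz.
Qed.

(** The kernel consists of the classes of [z] with [a * z] in the lattice of [Y],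
    and by mul_period_index such a class depends only on the coordinates of
    [a * z] modulo [D]. *)
Lemma lifts_isogeny (f : X -> Y) : lifts f a -> isogeny f.
Proof.
move=> fa; split; first exact: lifts_ellHom fa.
  apply/seteqP; split => // y _; have [z ->] := unif_surj y.
  by exists (unif X (z / a)) => //; rewrite fa mulrC divfK.
have [D D0 hD] := mul_period_index; have [y1 [y2 bY]] := period_basis Y.
pose rep (ij : 'I_(`|D|%N.+1) * 'I_(`|D|%N.+1)) : X :=
  unif X ((y1 *~ ij.1 + y2 *~ ij.2) / a).
apply: (@sub_finite_set _ _ (rep @` setT)); last exact/finite_image/finite_finset.
move=> x; have [z -> /=] := unif_surj x.
rewrite fa -(unif0 Y) => /unif_eq; rewrite subr0 => /(bY.2 _).1[m [n az]].
have modD k : exists i : 'I_(`|D|%N.+1), (k %% D)%Z = i.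
  have := modz_ge0 k D0; have := ltz_mod k D0.
  case: (k %% D)%Z => // i iD _; exists (inord i).
  by rewrite inordK // ltnS ltnW.
have [i iE] := modD m; have [j jE] := modD n.
exists (i, j) => //; apply/esym/unif_eq.
rewrite /= -[z](mulfK a0) (mulrC z) az -mulrBl.
rewrite [in m in y1 *~ m](divz_eq m D) [in n in y2 *~ n](divz_eq n D) iE jE.
have -> : y1 *~ ((m %/ D)%Z * D + i) + y2 *~ ((n %/ D)%Z * D + j) - (y1 *~ i + y2 *~ j)
  = (y1 *~ (m %/ D)%Z + y2 *~ (n %/ D)%Z) *~ D.
  by rewrite -!(mulrzl y1) -!(mulrzl y2) -!(mulrzl (_ + _)) !(rmorphD, rmorphM) /=; ring.
by apply: hD; apply/(bY.2 _); exists (m %/ D)%Z, (n %/ D)%Z.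
Qed.

End Isogeny.

(** The multiplier 0 would make [f] constant, but [f] is onto and [Y] has a
    nonzero point. *)
Lemma isogeny_multiplier (R : realType) (X Y : ellipticCurve R) (f : X -> Y) :
  isogeny f ->
  exists2 a, multipliers X Y a & a != 0 /\ lifts f a.
Proof.
case=> hf fsurj _; have [a fa] := ellHom_lifts hf.
exists a; first exact: lifts_multiplier hf fa.
split => //; apply/eqP => a0.
suff : 0 = 1 :> Cplx R by move/esym/eqP; rewrite oner_eq0.
apply: (@unif_mul_eq _ Y) => z.
have [x _ <-] : range f (unif Y (1 * z)) by rewrite fsurj.
by have [w ->] := unif_surj x; rewrite fa a0 !mul0r.
Qed.

(** If [a] is the multiplier of an isogeny and [D] is as in mul_period_index, then
    [D / a] is the multiplier of an isogeny in the other direction. *)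
Lemma dual_multiplier (R : realType) (X Y : ellipticCurve R) :
  isogenous X Y -> exists2 b, multipliers Y X b & b != 0.
Proof.
case=> f /isogeny_multiplier[a aXY [a0 _]].
have [D D0 hD] := mul_period_index a0 aXY.
exists (D%:~R / a); last by rewrite mulf_neq0 ?invr_eq0 // intr_eq0.
by move=> z zY; rewrite mulrAC mulrzl; exact: hD.
Qed.

(** * Groups of multipliers *)

Section Subgroups.
Variables (V : zmodType) (S : set V).
Hypothesis Ssub : is_subgroup S.

Lemma subgroupD x y : S x -> S y -> S (x + y).
Proof.
move=> Sx Sy; rewrite -[y]opprK; apply: Ssub.2 => //.
by rewrite -[- y]sub0r; apply: Ssub.2 => //; exact: Ssub.1.
Qed.

Lemma subgroupMz x n : S x -> S (x *~ n).
Proof.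
have Sn k : S x -> S (x *+ k).
  move=> Sx; elim: k => [|k IH]; first exact: Ssub.1.
  by rewrite mulrS; exact: subgroupD.
case: n => k Sx; first exact: Sn.
by rewrite NegzE mulrNz -sub0r; apply: Ssub.2; [exact: Ssub.1|exact: Sn].
Qed.
End Subgroups.

Section Multipliers.
Variables (R : realType) (X Y : ellipticCurve R).

Lemma multipliers_subgroup : is_subgroup (multipliers X Y).
Proof.
split => [z _|b b' Hb Hb' z zX]; first by rewrite mul0r rpred0.
by rewrite mulrBl rpredB ?Hb ?Hb'.
Qed.

(** Evaluation at a nonzero period of [X] embeds the multipliers into the lattice
    of [Y]. *)
Lemma multipliers_discrete :
  exists2 e : R, 0 < e & forall b, multipliers X Y b -> b != 0 -> e <= sqn b.
Proof.
have [w wX w0] := period_nonzero X; have [e e0 he] := period_discrete Y.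
have sw0 : 0 < sqn w by rewrite sqn_gt0.
exists (e / sqn w); first by rewrite divr_gt0.
by move=> b Hb b0; rewrite ler_pdivrMr // -sqnM he ?Hb // mulf_neq0.
Qed.

(** This transfers integral linear combinations of multipliers to the maps that
    they induce. *)
Lemma lifted_subgroup (G : set (X -> Y)) : is_subgroup G ->
  is_subgroup [set a | exists2 f, G f & lifts f a].
Proof.
move=> [G0 GB]; split; first by exists 0 => //; exact: lifts0.
move=> a b [f Gf fa] [g Gg gb]; exists (f - g); [exact: GB|exact: liftsB].
Qed.

Lemma ellHom_subgroup : is_subgroup (ellHom X Y).
Proof.
split; first exact: lifts_ellHom (lifts0 X Y).
move=> f g /ellHom_lifts[a fa] /ellHom_lifts[b gb].
exact: lifts_ellHom (liftsB fa gb).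
Qed.

End Multipliers.

(** * Euclidean division by Gaussian and Eisenstein integers *)

Section Euclid.
Variable R : realType.

Definition quadratic_unit (c : Cplx R) := c ^+ 2 = - 1 \/ c ^+ 2 + c + 1 = 0.

Lemma round_int (x : R) : exists m : int, (x - m%:~R) ^+ 2 <= 1 / 4.
Proof.
exists (Num.floor (x + 1 / 2)).
have := real_floor_itv (num_real (x + 1 / 2)); set m := Num.floor _.
rewrite intrD => /andP[h1 h2]; nra.
Qed.

(** Write [c = x + i y] with [y != 0] and [y ^ 2 <= 1].  Rounding first the
    imaginary part of [z] to a multiple of [y], then the real part to an integer,
    leaves an error of at most [y ^ 2 / 4 + 1 / 4] in the squared modulus. *)
Lemma quadratic_unit_euclid c (z : Cplx R) : quadratic_unit c ->
  exists m n : int, sqn (z - (m%:~R + n%:~R * c)) <= 1 / 2.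
Proof.
case: c z => x y [u v] cU.
have [y0 y1] : y != 0 /\ y ^+ 2 <= 1.
  case: cU => /eqP; rewrite expr2 eq_complex /= => /andP[/eqP c1 /eqP c2].
    have /eqP : x * y = 0 by move: c2; rewrite oppr0 [y * x]mulrC; lra.
    rewrite mulf_eq0 => /orP[]/eqP u0; rewrite u0 in c1; last by nra.
    by split; [apply/eqP => v0; rewrite v0 in c1; lra|nra].
  have /eqP : (2 * x + 1) * y = 0 by rewrite -[RHS]c2; ring.
  rewrite mulf_eq0 => /orP[]/eqP u0; last by rewrite u0 in c1; nra.
  have xE : x = - (1 / 2) by lra.
  rewrite xE in c1.
  by split; [apply/eqP => v0; rewrite v0 in c1; lra|nra].
have [n hn] := round_int (v / y).
have [m hm] := round_int (u - n%:~R * x).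
exists m, n; rewrite -!ofReal_int /sqn /= !(mul0r, add0r, addr0, subr0).
have -> : v - n%:~R * y = (v / y - n%:~R) * y by field.
rewrite opprD addrA addrAC exprMn.
have := sqr_ge0 (v / y - n%:~R); nra.
Qed.

(** Choose [a] with squared modulus less than twice the infimum over the nonzero
    elements.  Euclidean division of [b] by [a] leaves a remainder in [H] whose
    squared modulus is at most half that of [a], hence below the infimum; so
    the remainder is 0. *)
Lemma quadratic_module_cyclic c (H : set (Cplx R)) (e : R) :
  quadratic_unit c -> is_subgroup H -> (forall b, H b -> H (b * c)) ->
  0 < e -> (forall b, H b -> b != 0 -> e <= sqn b) ->
  (exists2 b, H b & b != 0) ->
  exists a, [/\ H a, a != 0 &
    forall b, H b -> exists m n : int, b = a *~ m + (a * c) *~ n].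
Proof.
move=> cU Hsub Hc e0 He [b0 Hb0 b00].
pose S : set R := [set sqn b | b in [set b | H b /\ b != 0]].
have Se : lbound S e by move=> _ [b [Hb bn0] <-]; exact: He.
have Sinf : has_inf S by split; [exists (sqn b0), b0|exists e].
have r0 : 0 < inf S by apply: lt_le_trans e0 _; apply: lb_le_inf => //; exact: Sinf.1.
have [_ [a [Ha a0] <-] ar] := inf_adherent r0 Sinf.
exists a; split => // b Hb.
have [m [n hmn]] := quadratic_unit_euclid (b / a) cU.
exists m, n; apply/eqP; rewrite -subr_eq0; apply/negPn/negP => d0.
have Hd : H (b - (a *~ m + (a * c) *~ n)).
  apply: Hsub.2 => //; apply: subgroupD => //; apply: subgroupMz => //.
  exact: Hc.
have : inf S <= sqn (b - (a *~ m + (a * c) *~ n)).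
  by apply: ge_inf; [exact: Sinf.2|exists (b - (a *~ m + (a * c) *~ n))].
apply/negP; rewrite -ltNge.
have -> : b - (a *~ m + (a * c) *~ n) = (b / a - (m%:~R + n%:~R * c)) * a.
  by rewrite mulrBl divfK // -!(mulrzl a) -!(mulrzl (a * c)); ring.
by rewrite sqnM; have := sqn_ge0 a; nra.
Qed.
End Euclid.

(** * The module of homomorphisms *)

(** [c] is a primitive root of unity of order 3 or 4. *)
Lemma has_order_multiplier (R : realType) (X : ellipticCurve R) (f : X -> X) c :
  lifts f c -> has_order f 3 \/ has_order f 4 -> quadratic_unit c.
Proof.
move=> fc.
have iterc k : lifts (iter k f) (c ^+ k).
  elim: k => [|k IH]; first by move=> z; rewrite expr0 mul1r.
  by rewrite exprS; exact: lifts_comp fc IH.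
have iter_id k : iter k f =1 id <-> c ^+ k = 1.
  split => [fk|ck x].
    by apply: (@unif_mul_eq _ X) => z; rewrite -iterc fk mul1r.
  by have [z ->] := unif_surj x; rewrite iterc ck mul1r.
case=> -[_ /iter_id ck nk].
  right; have /eqP : (c - 1) * (c ^+ 2 + c + 1) = 0.
    by transitivity (c ^+ 3 - 1); [ring|rewrite ck subrr].
  rewrite mulf_eq0 subr_eq0 => /orP[/eqP c1|/eqP //].
  by have /nk[] : (0 < 1 < 3)%N by []; apply/iter_id; rewrite expr1.
left; have /eqP : (c ^+ 2 - 1) * (c ^+ 2 + 1) = 0.
  by transitivity (c ^+ 4 - 1); [ring|rewrite ck subrr].
rewrite mulf_eq0 subr_eq0 addr_eq0 => /orP[/eqP c1|/eqP //].
by have /nk[] : (0 < 2 < 4)%N by []; apply/iter_id.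
Qed.

Theorem theoremA1 (R : realType) (A B : ellipticCurve R) (lambda : B -> B)
    (isogAB : isogenous A B)
    (jB : jinv B = 0 \/ jinv B = 1728)
    (autB : automorphism lambda)
    (order3 : jinv B = 0 -> has_order lambda 3)
    (order4 : jinv B = 1728 -> has_order lambda 4) :
  exists psi : B -> A, isogeny psi /\
    ellHom B A = subgroup_gen [set psi; psi \o lambda].
Proof.
have ord : has_order lambda 3 \/ has_order lambda 4.
  by case: jB => [/order3|/order4]; [left|right].
have [c lc] := ellHom_lifts autB.1.
have cB : multipliers B B c := lifts_multiplier autB.1 lc.
have Hc b : multipliers B A b -> multipliers B A (b * c).
  by move=> Hb z zB; rewrite -mulrA; exact/Hb/cB.
have [e e0 he] := multipliers_discrete B A.
have [a [Ha a0 gen]] := quadratic_module_cyclic (has_order_multiplier lc ord)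
  (multipliers_subgroup B A) Hc e0 he (dual_multiplier isogAB).
have psia : lifts (mulHom A a) a := mulHom_lifts Ha.
have psic := lifts_comp psia lc.
exists (mulHom A a); split; first exact (lifts_isogeny a0 Ha psia).
apply/seteqP; split => [f hf G [Gsub Ggen]|f].
  have [b fb] := ellHom_lifts hf.
  have [m [n bE]] := gen b (lifts_multiplier hf fb).
  have Ksub := lifted_subgroup Gsub.
  have [g Gg gb] : [set a | exists2 f, G f & lifts f a] b.
    rewrite bE; apply: subgroupD => //; apply: subgroupMz => //.
      by exists (mulHom A a) => //; apply: Ggen; left.
    by exists (mulHom A a \o lambda) => //; apply: Ggen; right.
  by rewrite (lifts_inj fb gb).
apply; split; first exact: ellHom_subgroup.
by move=> _ [->|->]; [exact: lifts_ellHom psia|exact: lifts_ellHom psic].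
Qed.
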